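(* Let the real power series $\mathcal{A}(x)=\sum_{k=0}^\infty a_k x^k$ and $\mathcal{B}(x)=\sum_{k=0}^\infty b_k x^k$ converge on $(0,r)$ with $b_k>0$. Suppose there exist different integers $m_2>m_1\geq 1$ such that the sequence $\{a_k/b_k\}$ is increasing (decreasing) for all $k \in [0,m_1]_{\mathbb{N}} \cup [m_2,\infty)_{\mathbb{N}}$ and decreasing (increasing) for all $k \in [m_1,m_2]_{\mathbb{N}}$, and that $\{a_k/b_k\}_{0\leq k \leq m_1}$, $\{a_k/b_k\}_{m_1 \leq k \leq m_2}$ and $\{a_k/b_k\}_{k \geq m_2}$ are non-constant. Then: (C1) The function $x\mapsto \mathcal{A}(x)/\mathcal{B}(x)$ is increasing (decreasing) on $(0,r)$ if one of the following conditions holds: (i) $H_{\mathcal{A}, \mathcal{B}}(r^-) \geq (\leq)\, 0$ and $H_{\mathcal{A}', \mathcal{B}'}(r^-) \leq (\geq)\, 0$; (ii) $H_{\mathcal{A}, \mathcal{B}}(r^-) > (<)\, 0$, $H_{\mathcal{A}', \mathcal{B}'}(r^-) > (<)\, 0$, and $H_{\mathcal{A}, \mathcal{B}}(x) \geq (\leq)\, 0$ for all $x\in(0,r)$. (C2) There exists $x_1 \in (0,r)$ such that the function $x\mapsto \mathcal{A}(x)/\mathcal{B}(x)$ is increasing (decreasing) on $(0,x_1]$ and decreasing (increasing) on $[x_1,r)$ if one of the following conditions holds: (iii) $H_{\mathcal{A}, \mathcal{B}}(r^-) < (>)\, 0$ and $H_{\mathcal{A}', \mathcal{B}'}(r^-)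 \leq (\geq)\, 0$; (iv) $H_{\mathcal{A}, \mathcal{B}}(r^-) \leq (\geq)\, 0$ and $H_{\mathcal{A}', \mathcal{B}'}(r^-) > (<)\, 0$. (C3) There exist $x_2,x_3 \in (0,r)$ such that the function $x\mapsto \mathcal{A}(x)/\mathcal{B}(x)$ is increasing (decreasing) on $(0,x_2] \cup [x_3,r)$ and decreasing (increasing) on $[x_2,x_3]$ if: (v) $H_{\mathcal{A}, \mathcal{B}}(r^-) \geq (\leq)\, 0$, $H_{\mathcal{A}', \mathcal{B}'}(r^-) > (<)\, 0$, and there exists $x_0\in(0,r)$ such that $H_{\mathcal{A}, \mathcal{B}}(x_0) < (>)\, 0$.
   Context: The statement comprises two versions: one reads throughout the words and inequalities outside the parentheses, the other reads throughout the alternatives in parentheses. $\mathbb{N}=\{0,1,2,\dots\}$, $[a,b]_{\mathbb{N}}=[a,b]\cap\mathbb{N}$ and $[a,\infty)_{\mathbb{N}}=[a,\infty)\cap\mathbb{N}$. $\mathcal{A}'$, $\mathcal{B}'$ are the derivatives of $\mathcal{A}$, $\mathcal{B}$. For differentiable functions $F,G$, Yang's $H$-function is $H_{F,G}=\frac{F'}{G'}G-F$; in particular $H_{\mathcal{A}',\mathcal{B}'}=\frac{\mathcal{A}''}{\mathcal{B}''}\mathcal{B}'-\mathcal{A}'$. $H_{F,G}(r^-)$ denotes $\lim_{x\to r^-}H_{F,G}(x)$.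
   Formalization: In (v) the condition H_{A,B}(r^-) ≥ (≤) 0 is replaced by the strict > (<) 0, because (C3) fails when H_{A,B}(r^-) = 0, e.g. A = x - x^2, B = 1/(1-x), r = 1; that case is covered by (iv) with conclusion (C2). *)

(* Defs.v *)
From Stdlib Require Import Reals.
From Coquelicot Require Import Coquelicot.
Open Scope R_scope.

(* The boolean [up] selects one of two mirror-image versions of a statement:
   [true] keeps every inequality and monotonicity word, [false] reverses them
   all at once. *)
Definition ord (up : bool) (x y : Rbar) : Prop :=
  if up then Rbar_le x y else Rbar_le y x.

Definition sord (up : bool) (x y : Rbar) : Prop :=
  if up then Rbar_lt x y else Rbar_lt y x.

(* "Increasing" and "decreasing" are taken in the wide sense, both for
   sequences and for functions. *)
Definition seq_monotone_on (up : bool) (I : nat -> Prop) (u : nat -> R) : Prop :=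
  forall i j : nat, I i -> I j -> (i <= j)%nat -> ord up (u i) (u j).

Definition non_constant_on (I : nat -> Prop) (u : nat -> R) : Prop :=
  exists i j : nat, I i /\ I j /\ u i <> u j.

Definition monotone_on (up : bool) (D : R -> Prop) (f : R -> R) : Prop :=
  forall x y : R, D x -> D y -> x <= y -> ord up (f x) (f y).

(* The endpoint [r] may be [p_infty]. *)
Definition in_domain (r : Rbar) (x : R) : Prop := 0 < x /\ Rbar_lt x r.

Definition Yang_H (F G : R -> R) (x : R) : R :=
  Derive F x / Derive G x * G x - F x.

(* [l] is the limit of [f] at [r^-], possibly infinite; for finite [r] the
   filter is Coquelicot's [at_left r]. *)
Definition is_left_limit (f : R -> R) (r l : Rbar) : Prop :=
  filterlim f (within (fun x : R => Rbar_lt x r) (Rbar_locally r))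
            (Rbar_locally l).

(* Main.v *)
(* Write [c k = a k / b k].  Since [(A/B)' = B'/B^2 * H_{A,B}] and
   [H_{A,B}' = B B''/B'^2 * H_{A',B'}], the monotonicity of each function is
   governed by the sign of the next one.  The coefficient ratio of the pair
   (A', B') is [c] shifted by one, and [H_{A,B}(0) = b_0 (c_1 - c_0)], so a
   downward recursion, started from the Biernacki-Krzyz rule for monotone ratios,
   shows that [H_{A,B}] and [H_{A',B'}] have at most the sign pattern + - + and
   do not decrease in the last phase.  As [H_{A,B}] is positive near 0, the two
   limits at [r] then decide which part of the pattern occurs.  The mirror-image
   version follows by replacing [a] with [-a]. *)

Require Import Defs.
From Stdlib Require Import Reals Arith Lra Lia FunctionalExtensionality Classical Wf_nat.
From Coquelicot Require Import Coquelicot.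
Open Scope R_scope.

(** * Yang's function in terms of coefficients, and convergence below [r] *)

(** Formal derivatives replace [Derive], so passing to the derived pair is an operation on
    coefficients and induction over pairs becomes possible. *)
Definition yang (a b : nat -> R) (x : R) : R :=
  PSeries (PS_derive a) x / PSeries (PS_derive b) x * PSeries b x - PSeries a x.

Definition ratio (a b : nat -> R) (k : nat) : R := a k / b k.

(** Unlike [in_domain], this includes the point 0, where the starting values of Yang's function are
    read off. Using the radius makes it stable under [PS_derive]. *)
Definition converges_below (r : Rbar) (a : nat -> R) : Prop :=
  forall x : R, 0 <= x -> Rbar_lt x r -> Rbar_lt (Rabs x) (CV_radius a).

Definition admissible (r : Rbar) (a b : nat -> R) : Prop :=
  converges_below r a /\ converges_below r b /\ forall k, 0 < b k.

Lemma Rbar_lt_of_le (r : Rbar) (x y : R) : x <= y -> Rbar_lt y r -> Rbar_lt x r.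
Proof. intros h1 h2. now apply Rbar_le_lt_trans with y. Qed.

Lemma exists_between (r : Rbar) (x : R) :
  Rbar_lt x r -> exists y, x < y /\ Rbar_lt y r.
Proof.
  destruct r as [r| |]; simpl; intros h; [exists ((x + r) / 2) | exists (x + 1) | easy].
  - split; simpl; lra.
  - split; simpl; [lra | easy].
Qed.

(** For [y] strictly between [x] and [r] the terms of the convergent series tend to 0, so [y] cannot
    exceed the radius; hence [x] lies strictly inside. *)
Lemma converges_below_of_ex_pseries (r : Rbar) (a : nat -> R) :
  (forall x, in_domain r x -> ex_pseries a x) -> converges_below r a.
Proof.
  intros ha x h0 hr.
  destruct (exists_between r x hr) as [y [hxy hy]].
  apply Rbar_lt_le_trans with y; [simpl; rewrite Rabs_pos_eq; lra|].
  destruct (Rbar_le_lt_dec y (CV_radius a)) as [h|h]; [exact h|exfalso].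
  apply (CV_disk_outside a y); [rewrite Rabs_pos_eq; [exact h|lra]|].
  apply ex_series_lim_0.
  apply ex_series_ext with (fun n => scal (pow_n y n) (a n)).
  - intros n. rewrite pow_n_pow. apply Rmult_comm.
  - apply ha. split; [lra|exact hy].
Qed.

Lemma converges_below_derive (r : Rbar) (a : nat -> R) :
  converges_below r a -> converges_below r (PS_derive a).
Proof. intros h x. rewrite CV_radius_derive. apply h. Qed.

Lemma admissible_derive (r : Rbar) (a b : nat -> R) :
  admissible r a b -> admissible r (PS_derive a) (PS_derive b).
Proof.
  intros [ha [hb hp]]. repeat split; try now apply converges_below_derive.
  intros k. apply Rmult_lt_0_compat; [apply lt_0_INR; lia|apply hp].
Qed.

(** The factors [k + 1] cancel. This shift lowers the turning points of the ratio by one and drives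
    all the inductions below. *)
Lemma ratio_derive (r : Rbar) (a b : nat -> R) (k : nat) :
  admissible r a b -> ratio (PS_derive a) (PS_derive b) k = ratio a b (S k).
Proof.
  intros [_ [_ hp]]. unfold ratio, PS_derive. specialize (hp (S k)).
  assert (INR (S k) <> 0) by (apply not_0_INR; lia). field. split; lra.
Qed.

Lemma PSeries_nonneg (d : nat -> R) (x : R) :
  (forall k, 0 <= d k) -> 0 <= x -> ex_pseries d x -> 0 <= PSeries d x.
Proof.
  intros hd hx hs. rewrite <- (PSeries_const_0 x). apply Series_le.
  - intros n. rewrite Rmult_0_l. split; [lra|].
    apply Rmult_le_pos; [apply hd|now apply pow_le].
  - apply ex_series_ext with (2 := hs).
    intros n. rewrite pow_n_pow. apply Rmult_comm.
Qed.

Lemma PSeries_pos (d : nat -> R) (x : R) :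
  (forall k, 0 <= d k) -> 0 < d 0%nat -> 0 <= x ->
  Rbar_lt (Rabs x) (CV_radius d) -> 0 < PSeries d x.
Proof.
  intros hd h0 hx hs. destruct (Req_dec x 0) as [->|hne]; [now rewrite PSeries_0|].
  pose proof (CV_radius_inside _ _ hs) as he.
  rewrite PSeries_decr_1 by exact he.
  apply Rplus_lt_le_0_compat; [exact h0|].
  apply Rmult_le_pos; [exact hx|].
  apply PSeries_nonneg; [intros k; apply hd|exact hx|].
  apply ex_pseries_decr_1; [right; exists (/ x)|exact he].
  unfold mult, one; simpl. now field.
Qed.

Lemma PSeries_pos_below (r : Rbar) (b : nat -> R) (x : R) :
  converges_below r b -> (forall k, 0 < b k) -> 0 <= x -> Rbar_lt x r ->
  0 < PSeries b x.
Proof.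
  intros hb hp h0 hr. apply PSeries_pos; auto. intros k; now apply Rlt_le.
Qed.

(** * Value at 0 and derivatives of Yang's function and of the quotient *)

Lemma yang_0 (r : Rbar) (a b : nat -> R) :
  admissible r a b -> yang a b 0 = b 0%nat * (ratio a b 1 - ratio a b 0).
Proof.
  intros [_ [_ hp]]. unfold yang, ratio. rewrite !PSeries_0. unfold PS_derive. simpl.
  pose proof (hp 0%nat). pose proof (hp 1%nat). field. split; lra.
Qed.

(** The factor is [B B'' / B'^2]; it is hidden behind an existential because only its sign matters
    later. *)
Lemma is_derive_yang (r : Rbar) (a b : nat -> R) (x : R) :
  admissible r a b -> 0 <= x -> Rbar_lt x r ->
  exists p, 0 < p /\
    is_derive (yang a b) x (p * yang (PS_derive a) (PS_derive b) x).
Proof.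
  intros hab h0 hr.
  pose proof (admissible_derive _ _ _ hab) as hab'.
  pose proof (admissible_derive _ _ _ hab') as hab''.
  destruct hab as [ha [hb hp]]; destruct hab' as [ha' [hb' hp']];
  destruct hab'' as [ha'' [hb'' hp'']].
  pose proof (PSeries_pos_below r b x hb hp h0 hr) as p0.
  pose proof (PSeries_pos_below r _ x hb' hp' h0 hr) as p1.
  pose proof (PSeries_pos_below r _ x hb'' hp'' h0 hr) as p2.
  exists (PSeries b x * PSeries (PS_derive (PS_derive b)) x / PSeries (PS_derive b) x ^ 2).
  split.
  - apply Rdiv_lt_0_compat; [now apply Rmult_lt_0_compat|now apply pow_lt].
  - pose proof (is_derive_PSeries a x (ha x h0 hr)) as dA.
    pose proof (is_derive_PSeries b x (hb x h0 hr)) as dB.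
    pose proof (is_derive_PSeries _ x (ha' x h0 hr)) as dA'.
    pose proof (is_derive_PSeries _ x (hb' x h0 hr)) as dB'.
    pose proof (is_derive_div _ _ _ _ _ dA' dB' ltac:(lra)) as dq.
    pose proof (is_derive_mult _ _ _ _ _ dq dB Rmult_comm) as dm.
    pose proof (is_derive_minus _ _ _ _ _ dm dA) as dd.
    refine (eq_ind _ (fun l : R => is_derive (yang a b) x l) dd _ _).
    unfold yang, minus, plus, opp, mult; simpl. field. split; lra.
Qed.

Lemma is_derive_quotient (r : Rbar) (a b : nat -> R) (x : R) :
  admissible r a b -> 0 <= x -> Rbar_lt x r ->
  exists p, 0 < p /\
    is_derive (fun t => PSeries a t / PSeries b t) x (p * yang a b x).
Proof.
  intros hab h0 hr.
  pose proof (admissible_derive _ _ _ hab) as hab'.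
  destruct hab as [ha [hb hp]]; destruct hab' as [ha' [hb' hp']].
  pose proof (PSeries_pos_below r b x hb hp h0 hr) as p0.
  pose proof (PSeries_pos_below r _ x hb' hp' h0 hr) as p1.
  exists (PSeries (PS_derive b) x / PSeries b x ^ 2). split.
  - apply Rdiv_lt_0_compat; [easy|now apply pow_lt].
  - pose proof (is_derive_PSeries a x (ha x h0 hr)) as dA.
    pose proof (is_derive_PSeries b x (hb x h0 hr)) as dB.
    pose proof (is_derive_div _ _ _ _ _ dA dB ltac:(lra)) as dq.
    refine (eq_ind _ (fun l : R => is_derive _ x l) dq _ _).
    unfold yang. field. split; lra.
Qed.

(** * Monotonicity from a function with the sign of the derivative *)

Lemma mean_value_sign (r : Rbar) (f g : R -> R) (x y : R) :
  (forall t, 0 <= t -> Rbar_lt t r -> exists p, 0 < p /\ is_derive f t (p * g t)) ->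
  0 <= x -> x < y -> Rbar_lt y r ->
  exists t p, x < t < y /\ 0 < p /\ f y - f x = p * g t.
Proof.
  intros hf h0 hxy hr.
  destruct (MVT_cor2 f (Derive f) x y hxy) as [t [e ht]].
  - intros c hc. destruct (hf c) as [p [_ hd]]; [lra|apply (Rbar_lt_of_le r c y); [lra|easy]|].
    apply is_derive_Reals. now rewrite (is_derive_unique _ _ _ hd).
  - destruct (hf t) as [p [hp hd]]; [lra|apply (Rbar_lt_of_le r t y); [lra|easy]|].
    exists t, (p * (y - x)). repeat split; try easy.
    + apply Rmult_lt_0_compat; lra.
    + rewrite e, (is_derive_unique _ _ _ hd). ring.
Qed.

Section SignOfDerivative.

Variables (r : Rbar) (f g : R -> R).
Hypothesis derive_f : forall t, 0 <= t -> Rbar_lt t r ->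
  exists p, 0 < p /\ is_derive f t (p * g t).

Lemma nondecreasing_of_sign (x y : R) :
  0 <= x -> x <= y -> Rbar_lt y r -> (forall t, x < t < y -> 0 <= g t) -> f x <= f y.
Proof.
  intros h0 [hxy|<-] hr hg; [|lra].
  destruct (mean_value_sign r f g x y derive_f h0 hxy hr) as [t [p [ht [hp e]]]].
  pose proof (Rmult_le_pos p (g t) ltac:(lra) (hg t ht)). lra.
Qed.

Lemma nonincreasing_of_sign (x y : R) :
  0 <= x -> x <= y -> Rbar_lt y r -> (forall t, x < t < y -> g t <= 0) -> f y <= f x.
Proof.
  intros h0 [hxy|<-] hr hg; [|lra].
  destruct (mean_value_sign r f g x y derive_f h0 hxy hr) as [t [p [ht [hp e]]]].
  pose proof (Rmult_le_pos p (- g t) ltac:(lra) ltac:(specialize (hg t ht); lra)). lra.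
Qed.

Lemma increasing_of_sign (x y : R) :
  0 <= x -> x < y -> Rbar_lt y r -> (forall t, x < t < y -> 0 < g t) -> f x < f y.
Proof.
  intros h0 hxy hr hg.
  destruct (mean_value_sign r f g x y derive_f h0 hxy hr) as [t [p [ht [hp e]]]].
  pose proof (Rmult_lt_0_compat p (g t) hp (hg t ht)). lra.
Qed.

Lemma exists_pos_of_increase (x y : R) :
  0 <= x -> x < y -> Rbar_lt y r -> f x < f y -> exists t, x < t < y /\ 0 < g t.
Proof.
  intros h0 hxy hr hf. apply NNPP. intros hn.
  apply (Rlt_not_le _ _ hf). apply nonincreasing_of_sign; try lra; try easy.
  intros t ht. apply Rnot_lt_le. intros h. apply hn. now exists t.
Qed.

Lemma exists_neg_of_decrease (x y : R) :
  0 <= x -> x < y -> Rbar_lt y r -> f y < f x -> exists t, x < t < y /\ g t < 0.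
Proof.
  intros h0 hxy hr hf. apply NNPP. intros hn.
  apply (Rlt_not_le _ _ hf). apply nondecreasing_of_sign; try lra; try easy.
  intros t ht. apply Rnot_lt_le. intros h. apply hn. now exists t.
Qed.

Lemma continuous_of_derive (t : R) : 0 <= t -> Rbar_lt t r -> continuous f t.
Proof.
  intros h0 hr. destruct (derive_f t h0 hr) as [p [_ hd]].
  apply (ex_derive_continuous (V := R_NormedModule)). now eexists; exact hd.
Qed.

End SignOfDerivative.

(** * Sign of Yang's function from the shape of the coefficient ratio *)

Lemma continuous_pos_near (f : R -> R) (x : R) :
  continuous f x -> 0 < f x -> exists e, 0 < e /\ forall y, x < y < x + e -> 0 < f y.
Proof.
  intros hc hp.
  assert (hl : locally (f x) (fun z => 0 < z)) by now apply (open_gt 0).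
  destruct (hc _ hl) as [e he]. exists e. split; [apply cond_pos|].
  intros y hy. apply he. unfold ball; simpl. unfold AbsRing_ball, abs, minus, plus, opp; simpl.
  rewrite Rabs_pos_eq; lra.
Qed.

(* The Biernacki-Krzyz monotonicity rule.  With [l = A x / B x] and [N] the first
   index where [c N >= l], every term of
   [x (A' - l B') - N (A - l B) = sum (k - N) b_k (c_k - l) x^k] is nonnegative,
   while [A - l B] vanishes at [x]. *)
Lemma yang_nonneg_of_ratio_nondecreasing (r : Rbar) (a b : nat -> R) (x : R) :
  admissible r a b -> (forall k, ratio a b k <= ratio a b (S k)) ->
  0 <= x -> Rbar_lt x r -> 0 <= yang a b x.
Proof.
  intros hab hc h0 hr.
  assert (hmono : forall i j, (i <= j)%nat -> ratio a b i <= ratio a b j).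
  { intros i j hij. induction hij; [lra|]. eapply Rle_trans; eauto. }
  destruct (Req_dec x 0) as [->|hne].
  { rewrite (yang_0 r) by exact hab. destruct hab as [_ [_ hp]].
    apply Rmult_le_pos; [now apply Rlt_le|]. specialize (hc 0%nat). lra. }
  pose proof (admissible_derive _ _ _ hab) as hab'.
  destruct hab as [ha [hb hp]]; destruct hab' as [ha' [hb' hp']].
  pose proof (PSeries_pos_below r b x hb hp h0 hr) as p0.
  pose proof (PSeries_pos_below r _ x hb' hp' h0 hr) as p1.
  set (l := PSeries a x / PSeries b x).
  set (d := fun k => a k - l * b k).
  assert (ed : forall k, d k = b k * (ratio a b k - l)).
  { intros k. unfold d, ratio. specialize (hp k). field. lra. }
  assert (conv : forall u v, converges_below r u -> converges_below r v ->
    ex_pseries (fun k => u k - l * v k) x /\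
    PSeries (fun k => u k - l * v k) x = PSeries u x - l * PSeries v x).
  { intros u v hu hv.
    assert (hxu : ex_pseries u x) by (apply CV_radius_inside; auto).
    assert (hxv : ex_pseries (PS_scal l v) x).
    { apply ex_pseries_scal; [apply Rmult_comm|apply CV_radius_inside; auto]. }
    split.
    - exact (ex_pseries_minus _ _ _ hxu hxv).
    - rewrite <- PSeries_scal, <- PSeries_minus by assumption. reflexivity. }
  destruct (conv a b ha hb) as [exd vd]. fold d in exd, vd.
  destruct (conv _ _ ha' hb') as [exd' vd'].
  replace (PSeries a x - l * PSeries b x) with 0 in vd by (unfold l; field; lra).
  (* Such an index exists: otherwise all coefficients of [l B - A] are positive, and so is its value
     at [x], which is 0. *)
  destruct (classic (exists k, l <= ratio a b k)) as [hex|hnone].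
  2:{ exfalso. assert (hneg : forall k, 0 < - d k).
      { intros k. assert (ratio a b k < l) by (apply Rnot_le_lt; intros h; apply hnone; eauto).
        rewrite ed. pose proof (Rmult_lt_0_compat (b k) (l - ratio a b k) (hp k)). lra. }
      assert (he : ex_pseries (fun k => - d k) x) by exact (ex_pseries_opp _ _ exd).
      assert (hv : PSeries (fun k => - d k) x = 0).
      { change (PSeries (PS_opp d) x = 0). rewrite PSeries_opp, vd. ring. }
      rewrite PSeries_decr_1 in hv by exact he.
      assert (0 <= x * PSeries (PS_decr_1 (fun k => - d k)) x).
      { apply Rmult_le_pos; [exact h0|]. apply PSeries_nonneg.
        - intros k. apply Rlt_le, hneg.
        - exact h0.
        - apply ex_pseries_decr_1; [right; exists (/ x)|exact he].
          unfold mult, one; simpl. now field. }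
      specialize (hneg 0%nat). lra. }
  destruct (dec_inh_nat_subset_has_unique_least_element (fun k => l <= ratio a b k))
    as [N [[hN hmin] _]]; [intros n; apply classic|exact hex|].
  set (d' := fun k => PS_derive a k - l * PS_derive b k) in *.
  (* The shifted series is [x (A' - l B')], with coefficients [k * d k]. *)
  assert (exi : ex_pseries (PS_incr_1 d') x) by now apply ex_pseries_incr_1.
  assert (exs : ex_pseries (PS_scal (INR N) d) x).
  { apply ex_pseries_scal; [apply Rmult_comm|exact exd]. }
  assert (hpos : 0 <= PSeries (PS_minus (PS_incr_1 d') (PS_scal (INR N) d)) x).
  { apply PSeries_nonneg; [|exact h0|now apply ex_pseries_minus].
    intros k.
    replace (PS_minus (PS_incr_1 d') (PS_scal (INR N) d) k) with ((INR k - INR N) * d k).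
    2:{ unfold PS_minus, PS_scal, PS_incr_1, plus, opp, scal; simpl. unfold mult; simpl.
        destruct k as [|k]; [simpl; unfold zero; simpl; ring|].
        unfold d', d, PS_derive. ring. }
    rewrite ed. specialize (hp k).
    destruct (Nat.le_gt_cases N k) as [hk|hk].
    - pose proof (le_INR _ _ hk). pose proof (hmono _ _ hk).
      repeat apply Rmult_le_pos; lra.
    - pose proof (lt_INR _ _ hk).
      assert (ratio a b k < l).
      { apply Rnot_le_lt. intros h. specialize (hmin _ h). lia. }
      replace ((INR k - INR N) * (b k * (ratio a b k - l)))
        with ((INR N - INR k) * (b k * (l - ratio a b k))) by ring.
      repeat apply Rmult_le_pos; lra. }
  rewrite PSeries_minus, PSeries_incr_1, PSeries_scal, vd, vd' in hpos by assumption.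
  assert (hq : 0 <= PSeries (PS_derive a) x - l * PSeries (PS_derive b) x).
  { apply Rmult_le_reg_l with x; [lra|]. lra. }
  (* Since [A = l B] at [x], Yang's function there is [(A' - l B') B / B']. *)
  replace (yang a b x) with ((PSeries (PS_derive a) x - l * PSeries (PS_derive b) x)
    * (PSeries b x / PSeries (PS_derive b) x)) by (unfold yang, l; field; split; lra).
  apply Rmult_le_pos; [exact hq|]. now apply Rlt_le, Rdiv_lt_0_compat.
Qed.

Definition valley (c : nat -> R) (m : nat) : Prop :=
  (forall k, (k < m)%nat -> c (S k) <= c k) /\
  (forall k, (m <= k)%nat -> c k <= c (S k)).

(* Once positive, Yang's function of a valley-shaped pair is nondecreasing:
   it starts at a nonpositive value, so its derivative, which has the sign of
   Yang's function of the derived pair, was positive before. *)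
Lemma yang_nondecreasing_once_pos (m : nat) :
  forall (r : Rbar) (a b : nat -> R) (x y : R),
  admissible r a b -> valley (ratio a b) m ->
  0 <= x -> x <= y -> Rbar_lt y r -> 0 < yang a b x -> yang a b x <= yang a b y.
Proof.
  induction m as [|m IH]; intros r a b x y hab [hdec hinc] h0 hxy hr hx;
    pose proof (admissible_derive _ _ _ hab) as hab';
    pose proof (fun t => is_derive_yang r a b t hab) as hder.
  (* For [m = 0] the ratio is nondecreasing throughout, and the Biernacki-Krzyz rule applies to the
     derived pair. *)
  - apply (nondecreasing_of_sign r _ _ hder); try assumption.
    intros t ht. apply (yang_nonneg_of_ratio_nondecreasing r); [exact hab'| |lra|].
    + intros k. rewrite !(ratio_derive r) by exact hab. apply hinc. lia.
    + apply (Rbar_lt_of_le r t y); [lra|exact hr].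
  - assert (hy0 : yang a b 0 <= 0).
    { rewrite (yang_0 r) by exact hab. destruct hab as [_ [_ hp]].
      pose proof (hdec 0%nat ltac:(lia)).
      pose proof (Rmult_le_pos (b 0%nat) (ratio a b 0 - ratio a b 1) (Rlt_le _ _ (hp _))). lra. }
    assert (hx0 : 0 < x) by (destruct h0 as [h|<-]; [exact h|lra]).
    destruct (exists_pos_of_increase r _ _ hder 0 x) as [t [ht htp]];
      [lra|exact hx0|now apply (Rbar_lt_of_le r x y)|lra|].
    apply (nondecreasing_of_sign r _ _ hder); try assumption.
    (* By induction the derived function never drops below its positive value at [t], and
       [t < x < s]. *)
    intros s hs. apply Rlt_le, Rlt_le_trans with (1 := htp).
    apply (IH r); [exact hab'| |lra|lra| |exact htp].
    + split; intros k hk; rewrite !(ratio_derive r) by exact hab; [apply hdec|apply hinc]; lia.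
    + apply (Rbar_lt_of_le r s y); [lra|exact hr].
Qed.

(** The second parameter is the length of the descent, which a shift leaves unchanged while [m]
    decreases; at [m = 0] only a valley remains. *)
Definition hill_valley (c : nat -> R) (m n : nat) : Prop :=
  (forall k, (k < m)%nat -> c k <= c (S k)) /\
  (forall k, (m <= k < m + n)%nat -> c (S k) <= c k) /\
  (forall k, (m + n <= k)%nat -> c k <= c (S k)).

(* For a hill-valley pair Yang's function has the sign pattern + - + at most:
   after a negative value, a positive value can no longer decrease. *)
Lemma yang_nondecreasing_after_neg_pos (m n : nat) :
  forall (r : Rbar) (a b : nat -> R) (x y z : R),
  admissible r a b -> hill_valley (ratio a b) m n ->
  0 <= x -> x < y -> y <= z -> Rbar_lt z r ->
  yang a b x < 0 -> 0 < yang a b y -> yang a b y <= yang a b z.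
Proof.
  induction m as [|m IH]; intros r a b x y z hab [hinc [hdec hinc']] h0 hxy hyz hr hx hy.
  - apply (yang_nondecreasing_once_pos n r); try assumption; [|lra].
    split; intros k hk; [apply hdec|apply hinc']; lia.
  - pose proof (admissible_derive _ _ _ hab) as hab'.
    pose proof (fun t => is_derive_yang r a b t hab) as hder.
    assert (hy0 : 0 <= yang a b 0).
    { rewrite (yang_0 r) by exact hab. destruct hab as [_ [_ hp]].
      pose proof (hinc 0%nat ltac:(lia)). specialize (hp 0%nat).
      apply Rmult_le_pos; lra. }
    assert (hx0 : 0 < x) by (destruct h0 as [h|<-]; [exact h|lra]).
    assert (hyr : Rbar_lt y r) by now apply (Rbar_lt_of_le r y z).
    (* The fall from a nonnegative start to [x] and the rise from [x] to [y] give the derived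
       function a negative value at [s] and a positive one at [t > s], as the induction hypothesis
       requires. *)
    destruct (exists_neg_of_decrease r _ _ hder 0 x) as [s [hs hsn]];
      [lra|exact hx0|apply (Rbar_lt_of_le r x y); [lra|easy]|lra|].
    destruct (exists_pos_of_increase r _ _ hder x y) as [t [ht htp]];
      [lra|exact hxy|easy|lra|].
    apply (nondecreasing_of_sign r _ _ hder); [lra|assumption|assumption|].
    intros w hw. apply Rlt_le, Rlt_le_trans with (1 := htp).
    apply (IH r _ _ s); [exact hab'| |lra|lra|lra| |exact hsn|exact htp].
    + split; [|split]; intros k hk; rewrite !(ratio_derive r) by exact hab;
        [apply hinc|apply hdec|apply hinc']; lia.
    + apply (Rbar_lt_of_le r w z); [lra|exact hr].
Qed.

(** If [c 0 < c 1], the value at 0 is positive and continuity suffices. If [c 0 = c 1], the value at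
    0 is 0, and the function increases strictly because that of the derived pair is positive near 0
    by induction. *)
Lemma yang_pos_near_0 (m : nat) :
  forall (r : Rbar) (a b : nat -> R), Rbar_lt 0 r -> admissible r a b ->
  (forall k, (k < m)%nat -> ratio a b k <= ratio a b (S k)) ->
  ratio a b 0 < ratio a b m ->
  exists e, 0 < e /\ forall x, 0 < x < e -> Rbar_lt x r -> 0 < yang a b x.
Proof.
  induction m as [|m IH]; intros r a b hr0 hab hinc hlt; [lra|].
  pose proof (admissible_derive _ _ _ hab) as hab'.
  pose proof (fun t => is_derive_yang r a b t hab) as hder.
  destruct (hinc 0%nat ltac:(lia)) as [h1|h1].
  - destruct (continuous_pos_near (yang a b) 0) as [e [he hpos]].
    + apply (continuous_of_derive r _ _ hder); [lra|exact hr0].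
    + rewrite (yang_0 r) by exact hab. destruct hab as [_ [_ hp]].
      apply Rmult_lt_0_compat; [apply hp|lra].
    + exists e. split; [exact he|]. intros x hx _. apply hpos. lra.
  - destruct (IH r (PS_derive a) (PS_derive b) hr0 hab') as [e [he hpos]].
    + intros k hk. rewrite !(ratio_derive r) by exact hab. apply hinc. lia.
    + rewrite !(ratio_derive r) by exact hab. lra.
    + exists e. split; [exact he|]. intros x hx hr.
      assert (hy0 : yang a b 0 = 0) by (rewrite (yang_0 r) by exact hab; rewrite h1; ring).
      rewrite <- hy0. apply (increasing_of_sign r _ _ hder); [lra|lra|exact hr|].
      intros t ht. apply hpos; [lra|]. apply (Rbar_lt_of_le r t x); [lra|exact hr].
Qed.

(** * Left limits at a finite or infinite endpoint *)

Lemma left_limit_eventually (h : R -> R) (r l : Rbar) (y : R) (P : R -> Prop) :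
  is_left_limit h r l -> Rbar_locally l P -> Rbar_lt y r ->
  exists z, y < z /\ Rbar_lt z r /\ forall x, z <= x -> Rbar_lt x r -> P (h x).
Proof.
  intros hlim hP hy. specialize (hlim P hP). unfold filtermap, within in hlim.
  destruct (exists_between r y hy) as [y' [hy1 hy2]].
  destruct r as [r| |]; simpl in *; [| |easy].
  (* The point [r - e / 2] lies in the ball of radius [e] about [r]; the maximum with [y'] keeps the
     witness beyond [y]. *)
  - destruct hlim as [e he]. exists (Rmax y' (r - e / 2)).
    pose proof (cond_pos e). pose proof (Rmax_l y' (r - e / 2)).
    pose proof (Rmax_r y' (r - e / 2)).
    repeat split; [lra|apply Rmax_lub_lt; lra|].
    intros x hx hxr. apply he; [|exact hxr].
    unfold ball; simpl. unfold AbsRing_ball, abs, minus, plus, opp; simpl.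
    apply Rabs_def1; lra.
  - destruct hlim as [M hM]. exists (Rmax y' (M + 1)).
    pose proof (Rmax_l y' (M + 1)). pose proof (Rmax_r y' (M + 1)).
    repeat split; [lra|]. intros x hx _. apply hM; [lra|easy].
Qed.

Lemma left_limit_eventually_lt (h : R -> R) (r l : Rbar) (y t : R) :
  is_left_limit h r l -> Rbar_lt l t -> Rbar_lt y r ->
  exists z, y < z /\ Rbar_lt z r /\ forall x, z <= x -> Rbar_lt x r -> h x < t.
Proof.
  intros hlim hl. apply (left_limit_eventually h r l y (fun u => u < t)); [exact hlim|].
  destruct l as [l| |]; simpl in *; [now apply (open_lt t)|easy|exists t; easy].
Qed.

Lemma left_limit_eventually_gt (h : R -> R) (r l : Rbar) (y t : R) :
  is_left_limit h r l -> Rbar_lt t l -> Rbar_lt y r ->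
  exists z, y < z /\ Rbar_lt z r /\ forall x, z <= x -> Rbar_lt x r -> t < h x.
Proof.
  intros hlim hl. apply (left_limit_eventually h r l y (fun u => t < u)); [exact hlim|].
  destruct l as [l| |]; simpl in *; [now apply (open_gt t)|exists t; easy|easy].
Qed.

(** Agreement on [(0, r)] is enough because [r > 0] makes points near [r] positive. *)
Lemma is_left_limit_ext (h h' : R -> R) (r l : Rbar) :
  Rbar_lt 0 r -> (forall x, in_domain r x -> h x = h' x) ->
  is_left_limit h r l -> is_left_limit h' r l.
Proof.
  intros hr heq hlim P hP. specialize (hlim P hP). unfold filtermap, within in *.
  assert (hpos : Rbar_locally r (fun x => 0 < x)).
  { destruct r as [r| |]; simpl in *; [now apply (open_gt 0)|now exists 0|easy]. }
  generalize (filter_and _ _ hpos hlim). apply filter_imp.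
  intros x [h0 hx] hxr. rewrite <- heq; [now apply hx|now split].
Qed.

(** * Sign changes of a function determined by its limits *)

(** The point is the supremum of the points of [[u, w]] satisfying [P]. As [P] may fail there, the
    last clause speaks of points of [P] beyond every [x < s]. *)
Lemma last_point (P : R -> Prop) (u w : R) :
  u <= w -> P u ->
  exists s, u <= s <= w /\ (forall x, s < x <= w -> ~ P x) /\
    (forall x, x < s -> exists y, x < y <= w /\ u <= y /\ P y).
Proof.
  intros huw hu.
  destruct (completeness (fun x => u <= x <= w /\ P x)) as [s [hub hlub]].
  - exists w. intros x [hx _]. lra.
  - exists u. split; [lra|exact hu].
  - exists s. repeat split.
    + apply hub. split; [lra|exact hu].
    + apply hlub. intros x [hx _]. lra.
    + intros x hx hp. assert (x <= s); [|lra]. apply hub. split; [|exact hp].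
      assert (u <= s) by (apply hub; split; [lra|exact hu]). lra.
    + intros x hx. apply NNPP. intros hn. assert (s <= x); [|lra].
      apply hlub. intros y [hy hp]. apply Rnot_lt_le. intros hxy.
      apply hn. exists y. repeat split; try easy; lra.
Qed.

Section SignPattern.

(** Here [h] and [k] stand for Yang's functions of the pair and of the derived pair. *)
Variables (r : Rbar) (h k : R -> R) (l0 l1 : Rbar).
Hypothesis r_pos : Rbar_lt 0 r.
Hypothesis derive_h : forall t, 0 <= t -> Rbar_lt t r ->
  exists p, 0 < p /\ is_derive h t (p * k t).
Hypothesis h_pattern : forall x y z, 0 <= x -> x < y -> y <= z -> Rbar_lt z r ->
  h x < 0 -> 0 < h y -> h y <= h z.
Hypothesis k_pattern : forall x y z, 0 <= x -> x < y -> y <= z -> Rbar_lt z r ->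
  k x < 0 -> 0 < k y -> k y <= k z.
Hypothesis h_start : exists e, 0 < e /\ forall x, 0 < x < e -> Rbar_lt x r -> 0 < h x.
Hypothesis h_limit : is_left_limit h r l0.
Hypothesis k_limit : is_left_limit k r l1.

Lemma exists_pos_before (w : R) : in_domain r w -> exists x, 0 < x < w /\ 0 < h x.
Proof.
  intros [hw hr]. destruct h_start as [e [he hp]].
  pose proof (Rmin_glb_lt w e 0 hw he). pose proof (Rmin_l w e). pose proof (Rmin_r w e).
  exists (Rmin w e / 2). split; [lra|]. apply hp; [lra|].
  apply (Rbar_lt_of_le r _ w); [lra|exact hr].
Qed.

(** If [h x < 0], the descent to [x] makes [k] negative somewhere, and the limit [l0 >= 0] forces a
    later rise, where [k] is positive. By its pattern [k] then stays above a positive constant,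
    against [l1 <= 0]. *)
Lemma nonneg_of_limits :
  Rbar_le 0 l0 -> Rbar_le l1 0 -> forall x, in_domain r x -> 0 <= h x.
Proof.
  intros hl0 hl1 x [hx hr]. apply Rnot_lt_le. intros hneg.
  destruct (exists_pos_before x) as [w [hw hwp]]; [now split|].
  destruct (exists_neg_of_decrease r h k derive_h w x) as [s [hs hsn]]; try easy; try lra.
  destruct (left_limit_eventually_gt h r l0 x (h x) h_limit) as [y [hxy [hyr hy]]];
    [now apply Rbar_lt_le_trans with 0|exact hr|].
  specialize (hy y (Rle_refl y) hyr).
  destruct (exists_pos_of_increase r h k derive_h x y) as [t [ht htp]]; try easy; try lra.
  destruct (left_limit_eventually_lt k r l1 y (k t) k_limit) as [z [hyz [hzr hz]]];
    [now apply Rbar_le_lt_trans with 0|exact hyr|].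
  specialize (hz z (Rle_refl z) hzr).
  assert (k t <= k z); [|lra]. apply (k_pattern s); try easy; lra.
Qed.

(** The sign changes at the supremum of the points up to [w] where [h] is positive: a negative value
    before it would be followed by a positive one. *)
Lemma pos_then_neg (w : R) :
  in_domain r w -> (forall x y, 0 < x -> x < y -> y <= w -> h x < 0 -> ~ 0 < h y) ->
  exists s, 0 < s <= w /\ (forall x, 0 < x < s -> 0 <= h x) /\
    (forall x, s < x <= w -> h x <= 0).
Proof.
  intros hw hno. destruct (exists_pos_before w hw) as [u [hu hup]].
  destruct (last_point (fun x => 0 < h x) u w) as [s [hs [hafter hbefore]]]; [lra|exact hup|].
  exists s. split; [lra|]. split.
  - intros x hx. apply Rnot_lt_le. intros hneg.
    destruct (hbefore x) as [y [hy [_ hyp]]]; [lra|].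
    apply (hno x y); try easy; lra.
  - intros x hx. apply Rnot_lt_le. now apply hafter.
Qed.

(** A positive value after a negative one would persist by [h_pattern], against [l0 <= 0]. It
    remains to find one negative value [h w]; up to [w] the previous lemma applies, and beyond [w]
    no positive value can occur. *)
Lemma pos_then_neg_of_limits :
  Rbar_lt l0 0 \/ (Rbar_le l0 0 /\ Rbar_lt 0 l1) ->
  exists s, in_domain r s /\ (forall x, 0 < x < s -> 0 <= h x) /\
    (forall x, s < x -> Rbar_lt x r -> h x <= 0).
Proof.
  intros hl.
  assert (hl0 : Rbar_le l0 0) by (destruct hl as [hl|[hl _]]; [now apply Rbar_lt_le|exact hl]).
  assert (hno : forall x y, 0 < x -> x < y -> Rbar_lt y r -> h x < 0 -> ~ 0 < h y).
  { intros x y hx hxy hyr hxn hyp.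
    destruct (left_limit_eventually_lt h r l0 y (h y) h_limit) as [z [hyz [hzr hz]]];
      [now apply Rbar_le_lt_trans with 0|exact hyr|].
    specialize (hz z (Rle_refl z) hzr).
    assert (h y <= h z); [|lra]. apply (h_pattern x); try easy; lra. }
  assert (hneg : exists w, in_domain r w /\ h w < 0).
  { destruct hl as [hlt|[_ hl1]].
    - destruct (left_limit_eventually_lt h r l0 0 0 h_limit hlt r_pos) as [w [hw [hwr hwn]]].
      exists w. split; [now split|]. apply hwn; [lra|exact hwr].
    (* Beyond [w] the function [h] increases strictly, so [h w >= 0] would keep it above the
       positive number [h v], against [l0 <= 0]. *)
    - destruct (left_limit_eventually_gt k r l1 0 0 k_limit hl1 r_pos) as [w [hw [hwr hwp]]].
      exists w. split; [now split|]. apply Rnot_le_lt. intros hw0.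
      assert (hinc : forall x y, w <= x -> x < y -> Rbar_lt y r -> h x < h y).
      { intros x y hx hxy hyr. apply (increasing_of_sign r h k derive_h); try easy; try lra.
        intros t ht. apply hwp; [lra|]. apply (Rbar_lt_of_le r t y); [lra|exact hyr]. }
      destruct (exists_between r w hwr) as [v [hwv hvr]].
      pose proof (hinc w v ltac:(lra) hwv hvr).
      destruct (left_limit_eventually_lt h r l0 v (h v) h_limit) as [z [hvz [hzr hz]]];
        [apply Rbar_le_lt_trans with 0; [exact hl0|simpl; lra]|exact hvr|].
      specialize (hz z (Rle_refl z) hzr). pose proof (hinc v z ltac:(lra) hvz hzr). lra. }
  destruct hneg as [w [[hw hwr] hwn]].
  destruct (pos_then_neg w) as [s [hs [hbefore hafter]]]; [now split| |].
  { intros x y hx hxy hyw. apply hno; try easy. now apply (Rbar_lt_of_le r y w). }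
  exists s. split; [split; [easy|now apply (Rbar_lt_of_le r s w)]|].
  split; [exact hbefore|]. intros x hx hxr.
  destruct (Rle_lt_dec x w) as [hxw|hxw]; [now apply hafter|].
  apply Rnot_lt_le. now apply (hno w).
Qed.

(** The first change [s] comes from the interval up to [x0]; the second, [t], is the supremum of the
    points with [h <= 0] before the final positive phase. *)
Lemma pos_neg_pos_of_limits (x0 : R) :
  Rbar_lt 0 l0 -> in_domain r x0 -> h x0 < 0 ->
  exists s t, 0 < s /\ s < t /\ Rbar_lt t r /\ (forall x, 0 < x < s -> 0 <= h x) /\
    (forall x, s < x < t -> h x <= 0) /\ (forall x, t < x -> Rbar_lt x r -> 0 <= h x).
Proof.
  intros hl0 [hx0 hx0r] hn0.
  destruct (pos_then_neg x0) as [s [hs [hbefore hafter]]]; [now split| |].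
  { intros x y hx hxy hyx0 hxn hyp.
    assert (h y <= h x0); [|lra]. apply (h_pattern x); try easy; lra. }
  (* Starting the search for [t] at [x1 > x0] yields [s <= x0 < x1 <= t], hence [s < t]. *)
  assert (hx1 : exists x1, x0 < x1 /\ Rbar_lt x1 r /\ forall x, x0 <= x <= x1 -> h x < 0).
  { destruct (continuous_pos_near (fun x => - h x) x0) as [e [he hp]].
    - apply (continuous_opp h), (continuous_of_derive r h k derive_h); [lra|exact hx0r].
    - lra.
    - destruct (exists_between r x0 hx0r) as [v [hv hvr]].
      exists (Rmin v (x0 + e / 2)).
      pose proof (Rmin_l v (x0 + e / 2)). pose proof (Rmin_r v (x0 + e / 2)).
      repeat split.
      + apply Rmin_glb_lt; lra.
      + now apply (Rbar_lt_of_le r _ v).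
      + intros x [[hx| ->] hx']; [|exact hn0]. specialize (hp x ltac:(lra)). lra. }
  destruct hx1 as [x1 [hx01 [hx1r hn1]]].
  destruct (left_limit_eventually_gt h r l0 x1 0 h_limit hl0 hx1r) as [z [hz [hzr hzp]]].
  destruct (last_point (fun x => h x <= 0) x1 z) as [t [ht [hafter' hbefore']]];
    [lra|apply Rlt_le, hn1; lra|].
  exists s, t.
  split; [easy|]. split; [lra|]. split; [now apply (Rbar_lt_of_le r t z)|].
  split; [exact hbefore|]. split.
  - intros x hx. destruct (Rle_lt_dec x x0) as [h1|h1]; [apply hafter; lra|].
    destruct (Rle_lt_dec x x1) as [h2|h2]; [apply Rlt_le, hn1; lra|].
    (* A positive value here would persist after the negative one at [x0], yet [h] is nonpositive at
       some later [y]. *)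
    apply Rnot_lt_le. intros hxp.
    destruct (hbefore' x) as [y [hy [_ hyn]]]; [lra|].
    assert (h x <= h y); [|lra].
    apply (h_pattern x0); try easy; try lra. now apply (Rbar_lt_of_le r y z).
  - intros x hx hxr. destruct (Rle_lt_dec x z) as [h1|h1].
    + apply Rlt_le, Rnot_le_lt, hafter'. lra.
    + apply Rlt_le, hzp; [lra|exact hxr].
Qed.

End SignPattern.

(** * From signs of Yang's function to monotonicity of the quotient *)

Lemma yang_H_eq (r : Rbar) (a b : nat -> R) (x : R) :
  admissible r a b -> in_domain r x -> Yang_H (PSeries a) (PSeries b) x = yang a b x.
Proof.
  intros [ha [hb _]] [h0 hr]. unfold Yang_H, yang.
  rewrite !Derive_PSeries; [reflexivity|apply hb|apply ha]; try lra; exact hr.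
Qed.

(** The inner derivative is known to be the derived series only inside the disk, so it is replaced
    on a neighbourhood of [x]. *)
Lemma Derive_Derive_PSeries (r : Rbar) (a : nat -> R) (x : R) :
  converges_below r a -> in_domain r x ->
  Derive (Derive (PSeries a)) x = PSeries (PS_derive (PS_derive a)) x.
Proof.
  intros ha [h0 hr].
  rewrite (Derive_ext_loc _ (PSeries (PS_derive a))).
  - apply Derive_PSeries. apply (converges_below_derive r a ha); [lra|exact hr].
  - apply (locally_interval _ x 0 r); [exact h0|exact hr|].
    intros y hy hyr. apply Derive_PSeries, ha; [now apply Rlt_le|exact hyr].
Qed.

Lemma yang_H_derive_eq (r : Rbar) (a b : nat -> R) (x : R) :
  admissible r a b -> in_domain r x ->
  Yang_H (Derive (PSeries a)) (Derive (PSeries b)) x = yang (PS_derive a) (PS_derive b) x.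
Proof.
  intros [ha [hb _]] hx. unfold Yang_H, yang.
  rewrite !(Derive_Derive_PSeries r) by assumption. destruct hx as [h0 hr].
  rewrite !Derive_PSeries; [reflexivity|apply ha|apply hb]; try lra; exact hr.
Qed.

Lemma hill_valley_derive (r : Rbar) (a b : nat -> R) (m n : nat) :
  admissible r a b -> hill_valley (ratio a b) (S m) n ->
  hill_valley (ratio (PS_derive a) (PS_derive b)) m n.
Proof.
  intros hab [h1 [h2 h3]].
  split; [|split]; intros k hk; rewrite !(ratio_derive r) by exact hab;
    [apply h1|apply h2|apply h3]; lia.
Qed.

Lemma mainTheorem1_up (r : Rbar) (a b : nat -> R) (m1 m2 : nat) (l0 l1 : Rbar) :
  let c := ratio a b in
  let H0 := Yang_H (PSeries a) (PSeries b) in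
  let H1 := Yang_H (Derive (PSeries a)) (Derive (PSeries b)) in
  let f := fun x : R => PSeries a x / PSeries b x in
  Rbar_lt 0 r -> admissible r a b ->
  (1 <= m1)%nat -> (m1 < m2)%nat ->
  seq_monotone_on true (fun k => (k <= m1)%nat) c ->
  seq_monotone_on false (fun k => (m1 <= k <= m2)%nat) c ->
  seq_monotone_on true (fun k => (m2 <= k)%nat) c ->
  non_constant_on (fun k => (k <= m1)%nat) c ->
  is_left_limit H0 r l0 ->
  is_left_limit H1 r l1 ->
  ((Rbar_le 0 l0 /\ Rbar_le l1 0) \/
   (forall x : R, in_domain r x -> Rbar_le 0 (H0 x)) ->
   monotone_on true (in_domain r) f)
  /\
  (Rbar_lt l0 0 \/ (Rbar_le l0 0 /\ Rbar_lt 0 l1) ->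
   exists x1 : R, in_domain r x1 /\
     monotone_on true (fun x => 0 < x <= x1) f /\
     monotone_on false (fun x => x1 <= x /\ Rbar_lt x r) f)
  /\
  (Rbar_lt 0 l0 /\ (exists x0 : R, in_domain r x0 /\ Rbar_lt (H0 x0) 0) ->
   exists x2 x3 : R, in_domain r x2 /\ in_domain r x3 /\ x2 < x3 /\
     monotone_on true (fun x => 0 < x <= x2) f /\
     monotone_on false (fun x => x2 <= x <= x3) f /\
     monotone_on true (fun x => x3 <= x /\ Rbar_lt x r) f).
Proof.
  intros c H0 H1 f hr hab hm1 hm12 hc1 hc2 hc3 hnc hl0 hl1.
  pose proof (admissible_derive _ _ _ hab) as hab'.
  pose proof (fun t => is_derive_yang r a b t hab) as hder.
  pose proof (fun t => is_derive_quotient r a b t hab) as fder.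
  apply (is_left_limit_ext _ (yang a b)) in hl0;
    [|exact hr|intros x hx; now apply (yang_H_eq r)].
  apply (is_left_limit_ext _ (yang (PS_derive a) (PS_derive b))) in hl1;
    [|exact hr|intros x hx; now apply (yang_H_derive_eq r)].
  assert (hv : hill_valley (ratio a b) m1 (m2 - m1)).
  { split; [|split]; intros k hk; [apply hc1|apply hc2|apply hc3]; lia. }
  pose proof (fun x y z => yang_nondecreasing_after_neg_pos _ _ r a b x y z hab hv) as hpat.
  (* The hypothesis [1 <= m1] makes this truncated subtraction exact. *)
  assert (hv' : hill_valley (ratio (PS_derive a) (PS_derive b)) (m1 - 1) (m2 - m1)).
  { apply (hill_valley_derive r); [exact hab|]. now replace (S (m1 - 1)) with m1 by lia. }
  pose proof (fun x y z => yang_nondecreasing_after_neg_pos _ _ r _ _ x y z hab' hv') as kpat.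
  assert (hst : exists e, 0 < e /\ forall x, 0 < x < e -> Rbar_lt x r -> 0 < yang a b x).
  { apply (yang_pos_near_0 m1); try assumption; [apply hv|].
    (* For a nondecreasing ratio, non-constancy up to [m1] means that its end values differ. *)
    assert (hlt : forall i j, (i <= m1)%nat -> (j <= m1)%nat -> c i < c j -> c 0%nat < c m1).
    { intros i j hi hj hij.
      pose proof (hc1 0%nat i (Nat.le_0_l m1) hi (Nat.le_0_l i)) as h1.
      pose proof (hc1 j m1 hj (Nat.le_refl m1) hj) as h2.
      change (c 0%nat <= c i) in h1. change (c j <= c m1) in h2. lra. }
    destruct hnc as [i [j [hi [hj hne]]]].
    destruct (Rtotal_order (c i) (c j)) as [h|[h|h]]; [now apply (hlt i j)|easy|now apply (hlt j i)]. }
  split; [|split].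
  - intros hcase.
    assert (hpos : forall x, in_domain r x -> 0 <= yang a b x).
    { destruct hcase as [[h1 h2]|h1].
      - exact (nonneg_of_limits r _ _ l0 l1 hder kpat hst hl0 hl1 h1 h2).
      - intros x hx. rewrite <- (yang_H_eq r) by assumption. now apply h1. }
    intros x y [hx hxr] [hy hyr] hxy.
    apply (nondecreasing_of_sign r f _ fder); try easy; try lra.
    intros t ht. apply hpos. split; [lra|]. apply (Rbar_lt_of_le r t y); [lra|exact hyr].
  - intros hcase.
    destruct (pos_then_neg_of_limits r _ _ l0 l1 hr hder hpat hst hl0 hl1 hcase)
      as [s [[hs hsr] [hp hn]]].
    exists s. split; [now split|]. split.
    + intros x y hx hy hxy. apply (nondecreasing_of_sign r f _ fder); try easy; try lra.
      * now apply (Rbar_lt_of_le r y s).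
      * intros t ht. apply hp. lra.
    + intros x y [hx hxr] [hy hyr] hxy.
      apply (nonincreasing_of_sign r f _ fder); try easy; try lra.
      intros t ht. apply hn; [lra|]. apply (Rbar_lt_of_le r t y); [lra|exact hyr].
  - intros [h1 [x0 [hx0 hneg]]]. unfold H0 in hneg.
    rewrite (yang_H_eq r) in hneg by assumption.
    destruct (pos_neg_pos_of_limits r _ _ l0 hder hpat hst hl0 x0 h1 hx0 hneg)
      as [s [t [hs [hst' [htr [hp [hn hp']]]]]]].
    exists s, t. repeat split; try easy; try lra.
    + apply (Rbar_lt_of_le r s t); [lra|exact htr].
    + intros x y hx hy hxy. apply (nondecreasing_of_sign r f _ fder); try easy; try lra.
      * apply (Rbar_lt_of_le r y t); [lra|exact htr].
      * intros u hu. apply hp. lra.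
    + intros x y hx hy hxy. apply (nonincreasing_of_sign r f _ fder); try easy; try lra.
      * apply (Rbar_lt_of_le r y t); [lra|exact htr].
      * intros u hu. apply hn. lra.
    + intros x y [hx hxr] [hy hyr] hxy.
      apply (nondecreasing_of_sign r f _ fder); try easy; try lra.
      intros u hu. apply hp'; [lra|]. apply (Rbar_lt_of_le r u y); [lra|exact hyr].
Qed.

(** * Negation of [a] and the mirror-image version *)

(** Yang's function is odd in [F]. Equality of functions allows rewriting inside [is_left_limit]. *)
Lemma Yang_H_opp (F G : R -> R) :
  Yang_H (fun x => - F x) G = fun x => - Yang_H F G x.
Proof.
  apply functional_extensionality. intros x. unfold Yang_H, Rdiv.
  rewrite Derive_opp. ring.
Qed.

Lemma is_left_limit_opp (h : R -> R) (r l : Rbar) :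
  is_left_limit h r l -> is_left_limit (fun x => - h x) r (Rbar_opp l).
Proof. intros hl. exact (filterlim_comp _ _ _ _ _ _ _ _ hl (filterlim_Rbar_opp l)). Qed.

Lemma ord_opp (up : bool) (x y : R) : ord up x y -> ord (negb up) (- x) (- y).
Proof. destruct up; simpl; lra. Qed.

Lemma seq_monotone_on_opp (up : bool) (I : nat -> Prop) (u v : nat -> R) :
  (forall k, v k = - u k) -> seq_monotone_on up I u -> seq_monotone_on (negb up) I v.
Proof. intros e h i j hi hj hij. rewrite !e. now apply ord_opp, h. Qed.

Lemma monotone_on_opp (up : bool) (D : R -> Prop) (f g : R -> R) :
  (forall x, g x = - f x) -> monotone_on up D f -> monotone_on (negb up) D g.
Proof. intros e h x y hx hy hxy. rewrite !e. now apply ord_opp, h. Qed.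

Lemma Rbar_opp_0 : Rbar_opp 0 = 0.
Proof. simpl. f_equal. ring. Qed.

Lemma Rbar_opp_le_0 (l : Rbar) : Rbar_le 0 l -> Rbar_le (Rbar_opp l) 0.
Proof. rewrite <- Rbar_opp_0 at 2. apply Rbar_opp_le. Qed.

Lemma Rbar_opp_ge_0 (l : Rbar) : Rbar_le l 0 -> Rbar_le 0 (Rbar_opp l).
Proof. rewrite <- Rbar_opp_0 at 2. apply Rbar_opp_le. Qed.

Lemma Rbar_opp_lt_0 (l : Rbar) : Rbar_lt 0 l -> Rbar_lt (Rbar_opp l) 0.
Proof. rewrite <- Rbar_opp_0 at 2. apply Rbar_opp_lt. Qed.

Lemma Rbar_opp_gt_0 (l : Rbar) : Rbar_lt l 0 -> Rbar_lt 0 (Rbar_opp l).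
Proof. rewrite <- Rbar_opp_0 at 2. apply Rbar_opp_lt. Qed.

(* [l0] and [l1] are the left limits at [r] of Yang's functions for (A, B) and
   (A', B').  In the last clause [l0] must be nonzero: if [l0 = 0] then the
   second clause applies and its conclusion is incompatible with that of the
   last one, as for A x = x - x^2, B x = 1 / (1 - x), r = 1. *)
Theorem mainTheorem1 (up : bool) (r : Rbar) (a b : nat -> R) (m1 m2 : nat)
    (l0 l1 : Rbar) :
  let A := PSeries a in
  let B := PSeries b in
  let c := fun k : nat => a k / b k in
  let H0 := Yang_H A B in
  let H1 := Yang_H (Derive A) (Derive B) in
  let f := fun x : R => A x / B x in
  Rbar_lt 0 r ->
  (forall x : R, in_domain r x -> ex_pseries a x) ->
  (forall x : R, in_domain r x -> ex_pseries b x) ->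
  (forall k : nat, 0 < b k) ->
  (1 <= m1)%nat -> (m1 < m2)%nat ->
  seq_monotone_on up (fun k => (k <= m1)%nat) c ->
  seq_monotone_on (negb up) (fun k => (m1 <= k <= m2)%nat) c ->
  seq_monotone_on up (fun k => (m2 <= k)%nat) c ->
  non_constant_on (fun k => (k <= m1)%nat) c ->
  non_constant_on (fun k => (m1 <= k <= m2)%nat) c ->
  non_constant_on (fun k => (m2 <= k)%nat) c ->
  is_left_limit H0 r l0 ->
  is_left_limit H1 r l1 ->
  ((ord up 0 l0 /\ ord up l1 0) \/
   (sord up 0 l0 /\ sord up 0 l1 /\
    (forall x : R, in_domain r x -> ord up 0 (H0 x))) ->
   monotone_on up (in_domain r) f)
  /\
  ((sord up l0 0 /\ ord up l1 0) \/
   (ord up l0 0 /\ sord up 0 l1) ->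
   exists x1 : R, in_domain r x1 /\
     monotone_on up (fun x => 0 < x <= x1) f /\
     monotone_on (negb up) (fun x => x1 <= x /\ Rbar_lt x r) f)
  /\
  (sord up 0 l0 /\ sord up 0 l1 /\
   (exists x0 : R, in_domain r x0 /\ sord up (H0 x0) 0) ->
   exists x2 x3 : R, in_domain r x2 /\ in_domain r x3 /\ x2 < x3 /\
     monotone_on up (fun x => 0 < x <= x2) f /\
     monotone_on (negb up) (fun x => x2 <= x <= x3) f /\
     monotone_on up (fun x => x3 <= x /\ Rbar_lt x r) f).
Proof.
  intros A B c H0 H1 f hr ha hb hp hm1 hm12 hc1 hc2 hc3 hnc1 _ _ hl0 hl1.
  apply converges_below_of_ex_pseries in ha. apply converges_below_of_ex_pseries in hb.
  destruct up.
  - destruct (mainTheorem1_up r a b m1 m2 l0 l1) as [C1 [C2 C3]]; try assumption; [easy|].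
    split; [|split].
    + intros [h|[_ [_ h]]]; apply C1; [now left|now right].
    + intros [[h _]|h]; apply C2; [now left|now right].
    + intros [h1 [_ h2]]. now apply C3.
  (* Replacing [a] by its negative changes the sign of the ratio, of the quotient and of both Yang
     functions, so the increasing version applies with opposite limits. *)
  - assert (eA : PSeries (PS_opp a) = fun x => - A x).
    { apply functional_extensionality. intros x. apply PSeries_opp. }
    assert (eA' : Derive (fun x => - A x) = fun x => - Derive A x).
    { apply functional_extensionality. intros x. apply Derive_opp. }
    assert (ec : forall k, ratio (PS_opp a) b k = - c k).
    { intros k. unfold ratio, c, PS_opp, opp; simpl. specialize (hp k). field. lra. }
    assert (ef : forall x, f x = - (- A x / PSeries b x)).
    { intros x. unfold f, B, Rdiv. ring. }
    destruct (mainTheorem1_up r (PS_opp a) b m1 m2 (Rbar_opp l0) (Rbar_opp l1))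
      as [C1 [C2 C3]]; try assumption.
    + split; [|easy]. intros x. rewrite CV_radius_opp. apply ha.
    + now apply (seq_monotone_on_opp false _ c).
    + now apply (seq_monotone_on_opp true _ c).
    + now apply (seq_monotone_on_opp false _ c).
    + destruct hnc1 as [i [j [hi [hj hne]]]]. exists i, j. rewrite !ec.
      repeat split; try assumption. lra.
    + rewrite eA, Yang_H_opp. now apply is_left_limit_opp.
    + rewrite eA, eA', Yang_H_opp. now apply is_left_limit_opp.
    + rewrite eA in C1, C2, C3. rewrite Yang_H_opp in C1, C3. split; [|split].
      * intros h. apply (monotone_on_opp true _ _ _ ef), C1.
        destruct h as [[h1 h2]|[_ [_ h]]]; [left|right].
        -- split; [now apply Rbar_opp_ge_0|now apply Rbar_opp_le_0].
        -- intros x hx. apply (Rbar_opp_ge_0 (H0 x)). now apply h.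
      * intros h. destruct C2 as [x1 [hx1 [i1 i2]]].
        { destruct h as [[h _]|[h1 h2]]; [left|right].
          - now apply Rbar_opp_lt_0.
          - split; [now apply Rbar_opp_le_0|now apply Rbar_opp_gt_0]. }
        exists x1. split; [exact hx1|]. split.
        -- exact (monotone_on_opp true _ _ _ ef i1).
        -- exact (monotone_on_opp false _ _ _ ef i2).
      * intros [h1 [_ [x0 [hx0 h2]]]]. destruct C3 as [x2 [x3 [hx2 [hx3 [hlt [i1 [i2 i3]]]]]]].
        { split; [now apply Rbar_opp_gt_0|]. exists x0. split; [exact hx0|].
          now apply (Rbar_opp_lt_0 (H0 x0)). }
        exists x2, x3. split; [exact hx2|]. split; [exact hx3|]. split; [exact hlt|]. split; [|split].
        -- exact (monotone_on_opp true _ _ _ ef i1).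
        -- exact (monotone_on_opp false _ _ _ ef i2).
        -- exact (monotone_on_opp true _ _ _ ef i3).
Qed.
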